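(* Let $X$ be a locally compact Hausdorff space. An element $f\in C_0(X)$ is right-symmetric if and only if $M_f=X$. Hence, in particular, if $X$ is not compact, then $C_0(X)$ has no non-zero right-symmetric point.
   Context: $\mathbb{K}$ is $\mathbb{R}$ or $\mathbb{C}$. $C_0(X)$ is the space of continuous functions $X\to\mathbb{K}$ vanishing at infinity, with the supremum norm $\|\cdot\|$. For $f\in C_0(X)$, $M_f:=\{x\in X:|f(x)|=\|f\|\}$. In a normed space $\mathbb{X}$ over $\mathbb{K}$, $x\perp_B y$ (Birkhoff-James orthogonality) means $\|x+\lambda y\|\ge\|x\|$ for all $\lambda\in\mathbb{K}$; $x\in\mathbb{X}$ is right-symmetric if $y\perp_B x$ implies $x\perp_B y$ for every $y\in\mathbb{X}$. *)

(* Defs.v *)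
From HB Require Import structures.
From mathcomp Require Import all_boot all_order all_algebra.
From mathcomp Require Import all_classical all_reals topology normedtype.
From mathcomp.real_closed Require Import complex.

Set Implicit Arguments.
Unset Strict Implicit.
Unset Printing Implicit Defensive.

Import Order.TTheory GRing.Theory Num.Theory.
Import numFieldNormedType.Exports.

Local Open Scope classical_set_scope.
Local Open Scope ring_scope.

(** In a [normedModType K] the norm takes its values in [K]; over [R[i]] these
    values are nonnegative reals, on which the partial order of [R[i]]
    restricts to the order of [R]. *)
Definition bj_orthogonal (K : numFieldType) (V : normedModType K) (x y : V) :=
  forall l : K, `|x| <= `|x + l *: y|.

Definition right_symmetric (K : numFieldType) (V : normedModType K) (x : V) :=
  forall y : V, bj_orthogonal y x -> bj_orthogonal x y.

Section C0_lmodule.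
Context {X : topologicalType} {K : numFieldType}.
Implicit Types f g : X -> K.

Definition vanishes_at_infinity f :=
  forall eps : K, 0 < eps -> compact [set x | eps <= `|f x|].

Definition C0_pred : {pred X -> K} :=
  mem [set f | continuous f /\ vanishes_at_infinity f].

Lemma C0_predP f :
  reflect (continuous f /\ vanishes_at_infinity f) (f \in C0_pred).
Proof. by apply: (iffP idP); rewrite /C0_pred inE. Qed.

Lemma closed_ge_norm f (eps : K) : continuous f -> 0 < eps ->
  closed [set x | eps <= `|f x|].
Proof.
move=> cf e0.
have -> : [set x | eps <= `|f x|] = ~` [set x | `|f x| < eps].
  apply/seteqP; split => x /=; first by move=> h /(le_lt_trans h); rewrite ltxx.
  by move/negP; rewrite -real_leNgt ?normr_real ?gtr0_real.
apply: open_closedC.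
have -> : [set x | `|f x| < eps] = f @^-1` [set y | `|y| < eps] by [].
apply: open_comp; first by move=> x _; exact: cf.
have -> : [set y : K | `|y| < eps] = ball (0 : K) eps.
  by apply/seteqP; split => y; rewrite -ball_normE /ball_ /= sub0r normrN.
exact: ball_open.
Qed.

Lemma C0_submod_closed : submod_closed C0_pred.
Proof.
split.
  apply/C0_predP; split; first by move=> x; exact: cvg_cst.
  move=> e e0; rewrite (_ : mkset _ = set0); first exact: compact0.
  by apply/seteqP; split => x //=; rewrite normr0 => /(lt_le_trans e0); rewrite ltxx.
move=> a f g /C0_predP[cf vf] /C0_predP[cg vg]; apply/C0_predP.
have cafg : continuous (a *: f + g).
  move=> x; apply: (@cvgD _ K X (nbhs x) _ (a *: f) g); last exact: cg.
  by apply: cvgZr; exact: cf.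
split=> // e e0.
have a1 : 0 < `|a| + 1 by rewrite ltr_wpDl.
have e2 : 0 < e / 2 by rewrite divr_gt0.
have d0 : 0 < e / 2 / (`|a| + 1) by rewrite divr_gt0.
apply: (subclosed_compact (closed_ge_norm cafg e0)
          (compactU (vf _ d0) (vg _ e2))).
move=> x /= ex; apply: contrapT => /not_orP[/negP nf /negP ng].
move: nf ng; rewrite -!real_ltNge ?normr_real ?gtr0_real// => nf ng.
suff : `|a * f x + g x| < e by move=> /(le_lt_trans ex); rewrite ltxx.
rewrite (le_lt_trans (ler_normD _ _))// [ltRHS]splitr ler_ltD// normrM.
rewrite (@le_trans _ _ ((`|a| + 1) * `|f x|)) ?ler_wpM2r ?lerDl//.
by rewrite mulrC -ler_pdivlMr// ltW.
Qed.

HB.instance Definition _ :=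
  GRing.isSubmodClosed.Build K (X -> K) C0_pred C0_submod_closed.

End C0_lmodule.

Record C0 (X : topologicalType) (K : numFieldType) := MkC0 {
  C0_fun :> X -> K;
  _ : C0_fun \in C0_pred }.

HB.instance Definition _ (X : topologicalType) (K : numFieldType) :=
  [isSub for @C0_fun X K].
HB.instance Definition _ (X : topologicalType) (K : numFieldType) :=
  [Choice of C0 X K by <:].
HB.instance Definition _ (X : topologicalType) (K : numFieldType) :=
  [SubChoice_isSubLmodule of C0 X K by <:].

(** The default value of [supremum] only matters for empty [X], where it makes
    the norm of the unique function equal to 0. *)
Definition sup_norm (X : topologicalType) (K : numFieldType) (f : C0 X K) : K :=
  supremum 0 [set `|f x| | x in [set: X]].

Variant scalar_kind := RealScalars | ComplexScalars.

Definition scalar_field (R : realType) (k : scalar_kind) : numFieldType :=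
  match k with RealScalars => R | ComplexScalars => R[i]%C end.

Lemma scalar_supremums (R : realType) (k : scalar_kind)
    (A : set (scalar_field R k)) (M : scalar_field R k) :
  A !=set0 -> (forall a, A a -> 0 <= a <= M) -> supremums A !=set0.
Proof.
case: k A M => /= A M [a0 Aa0] AM.
  exists (sup A); split; first by apply: sup_upper_bound; split; [exists a0|exists M => a /AM /andP[]].
  by move=> u Au; apply: ge_sup => //; exists a0.
have AIm (a : R[i]%C) : A a -> a = (complex.Re a)%:C%C.
  by move=> /AM /andP[a0' _]; rewrite RRe_real// ger0_real.
have supA : has_sup (@complex.Re R @` A).
  split; first by exists (complex.Re a0), a0.
  by exists (complex.Re M) => _ [a /AM /andP[_ +] <-]; rewrite lecE => /andP[].
exists (sup (@complex.Re R @` A))%:C%C; split.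
  move=> a Aa; rewrite (AIm _ Aa) lecR.
  by apply: sup_upper_bound => //; exists a.
move=> u Au; have := Au _ Aa0; rewrite lecE => /andP[/eqP iu _].
rewrite lecE/= iu {1}(AIm _ Aa0)/= eqxx/=.
apply: ge_sup; first by exists (complex.Re a0), a0.
by move=> _ [a /Au + <-]; rewrite lecE => /andP[].
Qed.

Section C0_normed.
Context {R : realType} {k : scalar_kind} {X : topologicalType}.
Local Notation K := (scalar_field R k).
Implicit Types f g : C0 X K.

Lemma C0_continuous f : continuous f.
Proof. by case: f => f /= /C0_predP[]. Qed.

Lemma C0_vanishes f : vanishes_at_infinity f.
Proof. by case: f => f /= /C0_predP[]. Qed.

Lemma scalar_archi (x : K) : exists n : nat, `|x| < n%:R.
Proof.
case: k x => /= x; first by exists (Num.bound `|x|); exact: archi_boundP.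
exists (Num.bound (complex.Re `|x|)).
have xR : `|x| = (complex.Re `|x|)%:C%C by rewrite RRe_real ?normr_real.
rewrite xR -(rmorph_nat (real_complex R)) ltcR; apply: archi_boundP.
by rewrite -ler0c -xR.
Qed.

Lemma C0_bounded f : exists M : K, forall x, `|f x| <= M.
Proof.
have := @C0_vanishes f 1 ltr01.
move=> /compact_near_coveringP /(_ _ \oo (fun n y => `|f y| < n%:R) _) [].
  move=> x _; have [m fm] := scalar_archi (f x).
  exists ([set y | `|f y| < m%:R], [set n | (m <= n)%N]); last first.
    by move=> [y n] /= [fy mn]; rewrite (lt_le_trans fy)// ler_nat.
  split; last by exists m.
  apply: (@C0_continuous f x [set z | `|z| < m%:R] _); apply/nbhs_normP.
  exists (m%:R - `|f x|); first by rewrite /= subr_gt0.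
  move=> y /= fxy; rewrite -(subrK (f x) y) (le_lt_trans (ler_normD _ _))//.
  by rewrite -ltrBrDr distrC.
move=> n _ /(_ n (leqnn n)) fn; exists (n%:R + 1) => x.
have [x1|x1] := real_leP (normr_real (f x)) (@real1 K).
  by rewrite (le_trans x1)// lerDr ler0n.
by rewrite ltW// ltr_wpDr// fn//= ltW.
Qed.

Lemma sup_norm_lub f : [set: X] !=set0 ->
  supremums [set `|f x| | x in [set: X]] (sup_norm f).
Proof.
move=> [x0 _]; have [M fM] := C0_bounded f.
rewrite /sup_norm /supremum; case: ifPn => [/eqP|_].
  by move=> /seteqP[/(_ `|f x0|) /(_ (ex_intro2 _ _ x0 I erefl))].
case: xgetP => [y -> //|nosup].
have [] := @scalar_supremums R k [set `|f x| | x in [set: X]] M.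
- by exists `|f x0|, x0.
- by move=> _ [x _ <-]; rewrite normr_ge0 fM.
- by move=> s /nosup.
Qed.

Lemma le_sup_norm f x : `|f x| <= sup_norm f.
Proof. by have [+ _] := @sup_norm_lub f (ex_intro _ x I); apply; exists x. Qed.

Lemma sup_norm_ge0 f : 0 <= sup_norm f.
Proof.
have [[x _]|X0] := pselect ([set: X] !=set0).
  by rewrite (le_trans _ (le_sup_norm f x)).
rewrite /sup_norm /supremum; case: ifPn => // /set0P[_ [x _ _]].
by exfalso; apply: X0; exists x.
Qed.

Lemma sup_norm_le f (M : K) :
  0 <= M -> (forall x, `|f x| <= M) -> sup_norm f <= M.
Proof.
move=> M0 fM; have [X0|X0] := pselect ([set: X] !=set0).
  by have [_ ] := sup_norm_lub f X0; apply => _ [x _ <-].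
rewrite /sup_norm /supremum; case: ifPn => // /set0P[_ [x _ _]].
by exfalso; apply: X0; exists x.
Qed.

Lemma sup_normD f g : sup_norm (f + g) <= sup_norm f + sup_norm g.
Proof.
apply: sup_norm_le => [|x]; first by rewrite addr_ge0 ?sup_norm_ge0.
by rewrite (le_trans (ler_normD _ _))// lerD// le_sup_norm.
Qed.

Lemma sup_normZ_le (l : K) f : sup_norm (l *: f) <= `|l| * sup_norm f.
Proof.
apply: sup_norm_le => [|x]; first by rewrite mulr_ge0 ?sup_norm_ge0.
by rewrite normrM ler_wpM2l ?le_sup_norm.
Qed.

Lemma sup_normZ (l : K) f : sup_norm (l *: f) = `|l| * sup_norm f.
Proof.
apply/eqP; rewrite eq_le sup_normZ_le /=.
have [->|l0] := eqVneq l 0; first by rewrite normr0 mul0r sup_norm_ge0.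
rewrite -ler_pdivlMl ?normr_gt0//.
by have := sup_normZ_le l^-1 (l *: f); rewrite scalerA mulVf// scale1r normfV.
Qed.

Lemma sup_norm0_eq0 f : sup_norm f = 0 -> f = 0.
Proof.
move=> f0; apply: val_inj; apply/funext => x /=.
by apply/eqP; rewrite -normr_le0 -f0 le_sup_norm.
Qed.

HB.instance Definition _ := Lmodule_isNormed.Build K (C0 X K)
  sup_normD sup_normZ sup_norm0_eq0.

Lemma C0_normE f : `|f| = sup_norm f.
Proof. by []. Qed.

Definition norming_set f : set X := [set x | `|f x| = `|f|].

End C0_normed.

(* Main.v *)
Require Import Defs.
From mathcomp Require Import all_boot all_order all_algebra.
From mathcomp Require Import all_classical all_reals topology normedtype.
From mathcomp.real_closed Require Import complex.
From mathcomp Require Import ring.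
Import Order.TTheory GRing.Theory Num.Theory.
Import numFieldNormedType.Exports.
Local Open Scope classical_set_scope.
Local Open Scope ring_scope.

Set Implicit Arguments.
Unset Strict Implicit.
Unset Printing Implicit Defensive.

(** Why the theorem holds.

    Suppose that |f| is constant, equal to N, and that f is not orthogonal to
    g.  Some multiple h of g then satisfies ||f + h|| < N, which forces
    2 Re (conj (f x) * h x) <= ||f + h||^2 - N^2 < 0 at every x, with a bound
    that does not depend on x.  So adding a small positive multiple of f to h
    lowers |h x|^2 uniformly, and g is not orthogonal to f
    ([norming_full_right_symmetric]).  The scalars enter only through the
    identity [sqr_normD_scale], which expresses that real part by norms alone
    and so treats the real and complex cases at once.

    Conversely, suppose |f x0| < N = ||f||.  A bump function concentrated near
    x0, in a set where |f| stays below some c < N, turns -f into a function g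
    with ||g|| <= N, g = -f wherever |f| > c, and g x0 = u * N where u is the
    phase of f x0 ([exists_C0_reflection]).  Then g is orthogonal to f: a
    scalar l at distance at least 1 from 1 makes |g + l f| = |1 - l| |f| large
    near the norming points of f, and every other l makes it large at x0
    ([le_norm_addM_or_subr1]).  But f is not orthogonal to g, because moving f
    slightly towards g shrinks f where |f| is large and adds little where |f|
    is at most c ([right_symmetric_norming_full]).

    Finally, a nonzero function of constant modulus vanishes at infinity only
    if the space is compact ([norming_full_compact]). *)

(** The cross term 2 Re (conj a * b) of |b + t a|^2 does not depend on t, so it
    can be read off from the value at t = 1; the statement then needs no
    conjugation. *)
Lemma sqr_normD_scale (R : realType) (k : scalar_kind)
    (a b t : scalar_field R k) : 0 <= t ->
  `|b + t * a| ^+ 2 =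
  `|b| ^+ 2 + t * (`|a + b| ^+ 2 - `|a| ^+ 2 - `|b| ^+ 2) + t ^+ 2 * `|a| ^+ 2.
Proof.
case: k a b t => /= a b t t0.
  by rewrite !real_normK ?num_real//; ring.
have tc : (t^*)%C = t by apply/CrealP/ger0_real.
have nE (z : R[i]%C) : `|z| ^+ 2 = z * (z^*)%C.
  by rewrite -normCK.
by rewrite !nE !rmorphD !rmorphM /= tc; ring.
Qed.

Lemma real_to_scalar_continuous (R : realType) (k : scalar_kind) :
  exists c : R -> scalar_field R k,
    [/\ continuous c, c 0 = 0, c 1 = 1 & {homo c : r s / r <= s}].
Proof.
case: k => /=.
  by exists id; split => // x; exact: cvg_id.
exists (real_complex R); split => // [x|r s rs]; last by rewrite lecR.
apply/cvgrPdist_lt => e e0.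
have eE : e = (complex.Re e)%:C%C by rewrite RRe_real// gtr0_real.
have Re0 : 0 < complex.Re e by rewrite -ltcR -eE.
near=> y.
rewrite -rmorphB normc_def/= expr0n/= addr0 sqrtr_sqr eE ltcR.
near: y; move/cvgrPdist_lt: (@cvg_id _ (nbhs x)); exact.
Unshelve. all: by end_near. Qed.

(** A locally compact Hausdorff space is completely regular, because its
    one-point compactification is normal; the separating function takes real
    values, which are then embedded in the scalars. *)
Lemma urysohn_bump (R : realType) (k : scalar_kind) (X : topologicalType)
    (x0 : X) (V : set X) :
  locally_compact [set: X] -> hausdorff_space X -> open V -> V x0 ->
  exists phi : X -> scalar_field R k,
    [/\ continuous phi, phi x0 = 1, (forall x, 0 <= phi x <= 1)
      & forall x, ~ V x -> phi x = 0].
Proof.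
move=> lcX hX oV Vx0.
have sep : uniform_separator [set x0] (~` V).
  apply: (@locally_compact_completely_regular X R lcX hX x0 (~` V)).
    exact: open_closedC.
  by move=> /(_ Vx0).
have [h [hcont h01 hx0 hV]] := (@uniform_separatorP _ R _ _).1 sep.
have [c [cc c0 c1 cle]] := real_to_scalar_continuous R k.
exists (fun x => c (1 - h x)); split.
- move=> x; apply: (@continuous_comp _ _ _ (fun y => 1 - h y) c); last exact: cc.
  by apply: cvgB; [exact: cvg_cst|exact: hcont].
- by rewrite (_ : h x0 = 0) ?subr0//; apply: hx0; exists x0.
- move=> x; have : `[0, 1]%classic (h x) by apply: h01; exists x.
  rewrite /= in_itv/= => /andP[h0 h1].
  by rewrite -{1}c0 -c1 !cle// ?subr_ge0// gerBl.
- by move=> x Vx; rewrite (_ : h x = 1) ?subrr//; apply: hV; exists x.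
Qed.

Lemma C0_pred_compact_support (X : topologicalType) (K : numFieldType)
    (U : set X) (b : X -> K) :
  compact U -> continuous b -> (forall x, ~ U x -> b x = 0) -> b \in C0_pred.
Proof.
move=> cU cb bU; apply/C0_predP; split => // e e0.
apply: (subclosed_compact (closed_ge_norm cb e0) cU) => x /= eb.
apply: contrapT => /bU bx0.
by move: eb; rewrite bx0 normr0 => /(lt_le_trans e0); rewrite ltxx.
Qed.

Lemma bj_orthogonalZl (K : numFieldType) (V : normedModType K) (x y : V)
    (l : K) : bj_orthogonal x y -> bj_orthogonal (l *: x) y.
Proof.
have [->|l0] := eqVneq l 0; first by rewrite scale0r => _ m; rewrite normr0.
move=> xy m; have -> : l *: x + m *: y = l *: (x + (m / l) *: y).
  by rewrite scalerDr scalerA mulrCA divff// mulr1.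
by rewrite !normrZ ler_wpM2l.
Qed.

(** Since a + l b = (a + b) - (1 - l) b, if l is within 1 of 1 the subtracted
    term has norm at most b. *)
Lemma le_norm_addM_or_subr1 (K : numFieldType) (a b l : K) :
  0 <= b <= a -> 1 <= `|1 - l| \/ a <= `|a + l * b|.
Proof.
move=> /andP[b0 ba]; have [h|h] := real_leP (@real1 K) (normr_real (1 - l)).
  by left.
right; have -> : a + l * b = (a + b) - (1 - l) * b by ring.
have ab0 : 0 <= a + b by rewrite addr_ge0// (le_trans b0).
rewrite (le_trans _ (lerB_dist _ _))// ger0_norm// normrM (ger0_norm b0).
by rewrite -addrA lerDl subr_ge0 ler_piMl// ltW.
Qed.

Section C0_lemmas.
Context {R : realType} {k : scalar_kind} {X : topologicalType}.
Local Notation K := (scalar_field R k).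
Implicit Types f g : C0 X K.

(** A uniform gap between squares gives a uniform gap between norms, since
    e <= B^2 - v^2 <= (B - v) * 2B when 0 <= v <= B; this is what makes the
    inequality between the supremum and B strict. *)
Lemma C0_norm_lt f (B e : K) : 0 < B -> 0 < e ->
  (forall x, `|f x| ^+ 2 + e <= B ^+ 2) -> `|f| < B.
Proof.
move=> B0 e0 fB.
have d0 : 0 < e / (B + B) by rewrite divr_gt0// addr_gt0.
have fBd x : `|f x| <= B - e / (B + B).
  have fxB : `|f x| <= B.
    rewrite -(@ler_pXn2r _ 2)// ?nnegrE ?(ltW B0)//.
    by rewrite (le_trans _ (fB x))// lerDl ltW.
  rewrite lerBrDl -lerBrDr ler_pdivrMr ?addr_gt0//.
  rewrite (@le_trans _ _ ((B - `|f x|) * (B + `|f x|)))//.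
    by rewrite -subr_sqr lerBrDl.
  by rewrite ler_wpM2l ?subr_ge0// lerD2l.
have [[x _]|X0] := pselect ([set: X] !=set0).
  rewrite (@le_lt_trans _ _ (B - e / (B + B))) ?gtrBl//.
  by apply: sup_norm_le => //; rewrite (le_trans _ (fBd x)).
rewrite (le_lt_trans _ B0)//; apply: sup_norm_le => // x.
by case: X0; exists x.
Qed.

(** If f is not orthogonal to h, say ||f + h|| < ||f||, then constancy of |f|
    makes the derivative at t = 0 of |h x + t f x|^2 at most
    ||f + h||^2 - ||f||^2 < 0 for all x at once, so h is not orthogonal
    to f. *)
Lemma norming_full_right_symmetric f :
  norming_set f = [set: X] -> right_symmetric f.
Proof.
move=> Mf g /[swap] l /(bj_orthogonalZl l); move: (l *: g) => h hf.
have fN x : `|f x| = `|f| by have : norming_set f x by rewrite Mf.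
rewrite real_leNgt ?normr_real//; apply/negP => fh.
have N0 : 0 < `|f| by rewrite (le_lt_trans _ fh).
have h0 : 0 < `|h|.
  by rewrite normr_gt0; apply/negP => /eqP h0; move: fh; rewrite h0 addr0 ltxx.
pose d := `|f| ^+ 2 - `|f + h| ^+ 2.
have d0 : 0 < d by rewrite subr_gt0 ltr_pXn2r ?nnegrE.
(* This t minimises -t d + t^2 ||f||^2, with minimum -t^2 ||f||^2. *)
pose t := d / (`|f| ^+ 2 *+ 2).
have t0 : 0 < t by rewrite divr_gt0// mulrn_wgt0// exprn_gt0.
have := hf t; apply/negP; rewrite -real_ltNge ?normr_real//.
apply: (@C0_norm_lt _ _ (t ^+ 2 * `|f| ^+ 2)) => //.
  by rewrite mulr_gt0// exprn_gt0.
move=> x; have -> : (h + t *: f) x = h x + t * f x by [].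
rewrite sqr_normD_scale ?(ltW t0)// fN -subr_ge0.
have hx : `|h x| ^+ 2 <= `|h| ^+ 2 by rewrite ler_pXn2r ?nnegrE// le_sup_norm.
have fhx : `|f x + h x| ^+ 2 <= `|f + h| ^+ 2.
  by rewrite ler_pXn2r ?nnegrE//; exact: (le_sup_norm (f + h) x).
have td : t * (`|f| ^+ 2 *+ 2) = d.
  by rewrite mulfVK// mulrn_eq0/= expf_eq0/= gt_eqF.
have {}td : t * d = t ^+ 2 * `|f| ^+ 2 *+ 2 by rewrite -td; ring.
set rhs := (X in 0 <= X).
have -> : rhs = (`|h| ^+ 2 - `|h x| ^+ 2) + t * `|h x| ^+ 2
    + t * (`|f + h| ^+ 2 - `|f x + h x| ^+ 2).
  apply/eqP; rewrite -subr_eq0; apply/eqP.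
  transitivity (t * d - t ^+ 2 * `|f| ^+ 2 *+ 2); last by rewrite td subrr.
  by rewrite /rhs /d; ring.
have t0' := ltW t0; apply: addr_ge0; first apply: addr_ge0.
- by rewrite subr_ge0.
- by apply: mulr_ge0 => //; exact: exprn_ge0.
- by apply: mulr_ge0 => //; rewrite subr_ge0.
Qed.

Lemma norming_full_compact f :
  norming_set f = [set: X] -> f <> 0 -> compact [set: X].
Proof.
move=> Mf /eqP f0; have N0 : 0 < `|f| by rewrite normr_gt0.
have -> : [set: X] = [set x | `|f| <= `|f x|].
  by rewrite -Mf; apply/seteqP; split => x /= fx;
    [rewrite fx|apply/eqP; rewrite eq_le le_sup_norm].
exact: C0_vanishes.
Qed.

(** The function g is (u ||f|| + f) phi - f with phi a bump at x0.  At each point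
    it is a convex combination of -f x and u ||f||, so the bump costs nothing
    in norm, and it differs from -f only where |f| <= c.  The phase u makes
    g x0 and f x0 point in the same direction while g and f are opposite at
    the norming points of f. *)
Lemma exists_C0_reflection f x0 :
  locally_compact [set: X] -> hausdorff_space X -> `|f x0| < `|f| ->
  exists (g : C0 X K) (c u : K),
    [/\ 0 <= c < `|f|, `|u| = 1, f x0 = u * `|f x0|, g x0 = u * `|f| &
     forall x, `|g x| <= `|f| /\ (`|f x| <= c \/ g x = - f x)].
Proof.
move=> lcX hX fx0.
pose c := (`|f x0| + `|f|) / 2.
have [fc cN] : `|f x0| < c /\ c < `|f| by rewrite !midf_lt.
(* When f x0 = 0, any u of modulus 1 serves. *)
have [u [u1 fu]] : exists u, `|u| = 1 /\ f x0 = u * `|f x0|.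
  have [->|n0] := eqVneq (f x0) 0; first by exists 1; rewrite normr1 normr0 mulr0.
  exists (f x0 / `|f x0|); rewrite normrM normfV normr_id divff ?normr_eq0//.
  by rewrite mulfVK// normr_eq0.
have c0 : 0 < c by rewrite (le_lt_trans _ fc).
have [U] := lcX x0 I; rewrite withinET => Ux0 [cU _].
pose V := U° `&` ~` [set x | c <= `|f x|].
have oV : open V.
  apply: openI; first exact: open_interior.
  by apply/closed_openC/closed_ge_norm => //; exact: C0_continuous.
have Vx0 : V x0 by split => //=; apply/negP; rewrite -real_ltNge ?normr_real ?gtr0_real.
have [phi [cphi phi0 phi01 phiV]] := @urysohn_bump R k X x0 V lcX hX oV Vx0.
pose b x := phi x * (u * `|f| + f x).
have bP : b \in C0_pred.
  apply: (C0_pred_compact_support cU) => [x|x Ux].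
    apply: cvgM; first exact: cphi.
    by apply: cvgD; [exact: cvg_cst|exact: C0_continuous].
  by rewrite /b phiV ?mul0r// => -[/interior_subset].
have gE x : (MkC0 bP - f) x = b x - f x by [].
exists (MkC0 bP - f), c, u; split => //.
- by rewrite ltW.
- by rewrite gE /b phi0 mul1r addrK.
move=> x; rewrite gE; split.
  have /andP[p0 p1] := phi01 x.
  have -> : b x - f x = phi x * (u * `|f|) - (1 - phi x) * f x by rewrite /b; ring.
  rewrite (le_trans (ler_normB _ _))// !normrM u1 mul1r normr_id.
  rewrite (ger0_norm p0) ger0_norm ?subr_ge0//.
  rewrite -[leRHS](_ : phi x * `|f| + (1 - phi x) * `|f| = _); last by ring.
  by rewrite lerD2l ler_wpM2l ?subr_ge0// le_sup_norm.
have [Vx|nVx] := pselect (V x); last by right; rewrite /b phiV// mul0r add0r.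
left; case: Vx => _ /= /negP; rewrite -real_ltNge ?normr_real ?gtr0_real//.
exact: ltW.
Qed.

(** The function g of [exists_C0_reflection] is orthogonal to f, but f is not
    orthogonal to g as soon as |f| is smaller than ||f|| at some point. *)
Lemma right_symmetric_norming_full f :
  locally_compact [set: X] -> hausdorff_space X ->
  right_symmetric f -> norming_set f = [set: X].
Proof.
move=> lcX hX rsf; apply/seteqP; split => // x0 _; apply/eqP.
rewrite eq_le le_sup_norm/= real_leNgt ?normr_real//; apply/negP => fx0.
have [g [c [u [/andP[c0 cN] u1 fu gx0 gP]]]] := exists_C0_reflection lcX hX fx0.
have N0 : 0 < `|f| by rewrite (le_lt_trans _ fx0).
have gN : `|g| <= `|f| by apply: sup_norm_le => // x; have [] := gP x.
have cr : c \is Num.real by exact: ger0_real.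
have DE (g1 g2 : C0 X K) l x : (g1 + l *: g2) x = g1 x + l * g2 x by [].
have gf : bj_orthogonal g f.
  move=> l; rewrite (le_trans gN)//.
  have fx0b : 0 <= `|f x0| <= `|f| by rewrite normr_ge0 ltW.
  have [l1|l1] := le_norm_addM_or_subr1 l fx0b.
  - have fle x : `|f x| <= c \/ `|f x| <= `|g + l *: f|.
      have [_ [|gx]] := gP x; [by left|right].
      rewrite (le_trans _ (le_sup_norm _ x))//.
      rewrite DE gx.
      rewrite (_ : _ + _ = - ((1 - l) * f x)); last by ring.
      by rewrite normrN normrM ler_peMl.
    (* If ||g + l f|| < c, then c would bound |f| everywhere, although
       c < ||f||. *)
    have [cM|cM] := real_leP cr (normr_real (g + l *: f)).
      apply: sup_norm_le => // x.
      by have [fx|//] := fle x; exact: le_trans cM.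
    have /le_lt_trans/(_ cN) : `|f| <= c.
      apply: sup_norm_le => // x.
      by have [//|fx] := fle x; rewrite (le_trans fx)// ltW.
    by rewrite ltxx.
  - rewrite (le_trans _ (le_sup_norm _ x0))//.
    rewrite DE gx0 fu mulrCA -mulrDr.
    by rewrite normrM u1 mul1r.
have [_ mN] := midf_lt cN.
(* The convex combination s f + (1 - s) g is bounded by s ||f|| where g = -f,
   and by c + (1 - s) ||f|| where |f| <= c; this s makes both bounds equal to
   the midpoint of c and ||f||. *)
pose s := (c + `|f|) / 2 / `|f|.
have sN : s * `|f| = (c + `|f|) / 2 by rewrite mulfVK// gt_eqF.
have s0 : 0 <= s by rewrite divr_ge0// divr_ge0// addr_ge0.
have s1 : s <= 1 by rewrite ler_pdivrMr// mul1r ltW.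
have := rsf g gf (1 - s); apply/negP; rewrite -real_ltNge ?normr_real//.
rewrite (le_lt_trans _ mN)// -sN; apply: sup_norm_le => [|x].
  by rewrite mulr_ge0.
rewrite DE.
have [gx [fx|->]] := gP x.
  rewrite (le_trans (ler_normD _ _))// normrM (@ger0_norm _ (1 - s)) ?subr_ge0//.
  rewrite (_ : s * `|f| = c + (1 - s) * `|f|).
    by rewrite lerD// ler_wpM2l ?subr_ge0.
  by rewrite mulrBl mul1r sN addrA {2}[c + `|f|]splitr addrK.
rewrite (_ : _ + _ = s * f x); last by ring.
by rewrite normrM (ger0_norm s0) ler_wpM2l// le_sup_norm.
Qed.

End C0_lemmas.

Theorem theorem1p2p2 (R : realType) (k : scalar_kind) (X : topologicalType)
    (X_locally_compact : locally_compact [set: X])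
    (X_hausdorff : hausdorff_space X) :
  (forall f : C0 X (scalar_field R k),
     right_symmetric f <-> norming_set f = [set: X]) /\
  (~ compact [set: X] ->
     ~ exists f : C0 X (scalar_field R k), f <> 0 /\ right_symmetric f).
Proof.
split=> [f|ncX [f [f0 rsf]]].
  split; last exact: norming_full_right_symmetric.
  exact: right_symmetric_norming_full.
apply: ncX; apply: norming_full_compact f0.
exact: right_symmetric_norming_full.
Qed.
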